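(* Let $m\ge 4$ be even, $n=2^m-1$, let $i_1,i_2\in\{0,1,2,3\}$ with $i_1-i_2\equiv 1\pmod 2$ and $0\notin\{i_1,i_2\}$, let $\mathcal{C}=\mathcal{C}_{i_1,i_2}$ and let $\mathcal{C}^*$ be the extended code of $\mathcal{C}$. Then: (i) $\mathrm{Aut}(\mathcal{C}^* )\cong \mathrm{Aut}(\mathcal{C})\ltimes \mathbb{F}_2^m$ (a semidirect product with normal subgroup isomorphic to $\mathbb{F}_2^m$); (ii) the order of $\mathrm{Aut}(\mathcal{C}^* )$ is \[ (2^m-1)\cdot 2^{m-1}\cdot(2^{m-2}-1)\cdot 2^{m-3}\cdots(2^2-1)\cdot 2\cdot 2^m. \]
   Context: $\mathbb{F}_2$ is the binary field. Let $\alpha$ be a primitive element of $GF(2^m)$ and let $H_m$ be the $m\times n$ binary matrix whose $i$-th column $\mathbf{h}_i$ ($i=0,\dots,n-1$) is the coordinate vector of $\alpha^i$ with respect to the basis $1,\alpha,\dots,\alpha^{m-1}$ (so the columns are exactly the nonzero vectors of $\mathbb{F}_2^m$; $H_m$ is a parity check matrix of the Hamming code). For distinct $i_1,i_2\in\{0,1,2,3\}$, $\mathbf{v}_{i_1,i_2}=(v_0,\dots,v_{n-1})$ has $v_i=1$ iff the Hamming weight $\mathrm{wt}(\mathbf{h}_i)\equiv i_1$ or $i_2\pmod 4$; $\mathcal{C}_{i_1,i_2}$ is the code with parity check matrix $H_m$ with the row $\mathbf{v}_{i_1,i_2}$ appended. The extension of a code $C$ of length $n$ is $C^*=\{(c_\infty,c_0,\dots,c_{n-1}):(c_0,\dots,c_{n-1})\in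 C,\ c_\infty=\sum_i c_i\}$. $\mathrm{Aut}(C)$ denotes the group of coordinate permutations mapping the code $C$ into itself. *)

(* Defs.v *)
From HB Require Import structures.
From mathcomp Require Import all_boot all_order all_fingroup all_algebra all_solvable all_field.

Set Implicit Arguments.
Unset Strict Implicit.
Unset Printing Implicit Defensive.

Import GRing.Theory.
Local Open Scope ring_scope.

Definition code_of_pcm (r n : nat) (H : 'M['F_2]_(r, n)) : {set 'rV['F_2]_n} :=
  [set c : 'rV['F_2]_n | H *m c^T == 0].

(* The coordinate c_oo is placed first, at index ord0 of 'I_(1 + n). *)
Definition ext_code (n : nat) (C : {set 'rV['F_2]_n}) :
    {set 'rV['F_2]_(1 + n)} :=
  [set row_mx (\sum_(i < n) c 0 i)%:M c | c : 'rV['F_2]_n in C].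

Section CodeAut.
Variables (n : nat) (C : {set 'rV['F_2]_n}).

Definition code_aut : {set 'S_n} :=
  [set s : 'S_n | [forall c in C, col_perm s c \in C]].

Lemma code_aut_group_set : group_set code_aut.
Proof.
apply/group_setP; split.
  by rewrite inE; apply/forall_inP => c Cc; rewrite col_perm1.
move=> s t; rewrite !inE => /forall_inP sC /forall_inP tC.
by apply/forall_inP => c Cc; rewrite col_permM; apply/sC/tC.
Qed.

Canonical code_aut_group := Group code_aut_group_set.

End CodeAut.

Definition hwt (m : nat) (h : 'cV['F_2]_m) : nat :=
  #|[set j : 'I_m | h j 0 != 0]|.

Section Codes.
Variables (L : fieldExtType 'F_2) (alpha : L) (m : nat).

Definition Hmx : 'M['F_2]_(m, 2 ^ m - 1) :=
  \matrix_(j, i) coord [tuple alpha ^+ k | k < m] j (alpha ^+ i).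

Definition vrow (i1 i2 : nat) : 'rV['F_2]_(2 ^ m - 1) :=
  \row_i ((hwt (col i Hmx) == i1 %[mod 4])
          || (hwt (col i Hmx) == i2 %[mod 4]))%:R.

Definition Ccode (i1 i2 : nat) : {set 'rV['F_2]_(2 ^ m - 1)} :=
  code_of_pcm (col_mx Hmx (vrow i1 i2)).

End Codes.

(* Main.v *)
Require Import Defs.
From mathcomp Require Import all_boot all_order all_fingroup all_algebra all_solvable all_field.
From mathcomp Require Import mxabelem zify ring.
Set Implicit Arguments.
Unset Strict Implicit.
Unset Printing Implicit Defensive.
Import GRing.Theory Num.Theory.
Local Open Scope ring_scope.

(** Index the coordinates of the extended code by the vectors of F_2^m, the
    coordinate at infinity being 0. The dual code is then spanned by 1, the
    linear forms and a quadratic form q whose polar form has matrix J - I (J the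
    all-ones matrix), which is nondegenerate since m is even. The functions
    q + affine are bent, hence not balanced, while nonzero linear forms are
    balanced; so an automorphism maps linear forms to affine ones, i.e., it is
    an affine map x -> x A + b. Such a map is an automorphism exactly when A
    preserves J - I. Thus the group is the semidirect product of the
    translations with the stabiliser of 0, and the latter is Aut(C). The
    symplectic isometries A are counted one row at a time: a frame with Gram
    matrix J - I of size r has 2^(m-r) - [r even] extensions. *)

(** * Linear algebra: solution counts and independence of an added row *)

(** The solutions form a coset of the left kernel of M, which has dimension m - r. *)
Lemma card_mulmx_eq (F : finFieldType) m r (M : 'M[F]_(m, r)) (w : 'rV_r) :
  row_full M -> #|[set v : 'rV_m | v *m M == w]| = (#|F| ^ (m - r))%N.
Proof.
move=> Mfull; have Mw : (w *m pinvmx M) *m M = w.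
  by apply: mulmxKpV; apply: submx_full.
have -> : [set v | v *m M == w] =
          [set w *m pinvmx M + u | u in rowg (kermx M)].
  apply/setP=> v; rewrite inE; apply/eqP/imsetP => [vM | [u]].
    exists (v - w *m pinvmx M); last by rewrite addrC subrK.
    by rewrite inE; apply/sub_kermxP; rewrite mulmxBl vM Mw subrr.
  by rewrite inE => /sub_kermxP uM ->; rewrite mulmxDl uM Mw addr0.
rewrite card_imset; last exact: addrI.
by rewrite card_rowg mxrank_ker (eqP Mfull).
Qed.

Lemma row_free_col_mx1 (F : fieldType) m r (v : 'rV[F]_m) (X : 'M_(r, m)) :
  row_free (col_mx v X) = row_free X && ~~ (v <= X)%MS.
Proof.
apply/idP/andP => [fvX | [fX vX]].
  split.
    apply: inj_row_free => u uX.
    have : row_mx 0 u *m col_mx v X = 0 *m col_mx v X.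
      by rewrite mul_row_col !mul0mx add0r uX.
    by move/(row_free_inj fvX)/(congr1 rsubmx); rewrite row_mxKr linear0.
  apply/negP=> /submxP[D vD].
  have : row_mx 1%:M (- D) *m col_mx v X = 0 *m col_mx v X.
    by rewrite mul_row_col mul0mx mul1mx mulNmx -vD subrr.
  move/(row_free_inj fvX)/(congr1 lsubmx)/matrixP/(_ 0 0).
  by rewrite row_mxKl linear0 !mxE => /eqP; rewrite oner_eq0.
apply: inj_row_free => w; rewrite -[w]hsubmxK mul_row_col.
rewrite [lsubmx w]mx11_scalar mul_scalar_mx.
set a := lsubmx w 0 0; have [-> | a0] := eqVneq a 0.
  rewrite scale0r add0r => wX; have -> : rsubmx w = 0.
    by apply: (row_free_inj fX); rewrite mul0mx.
  by rewrite raddf0 row_mx0.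
move/eqP; rewrite addr_eq0 => /eqP avX; case/negP: vX.
by rewrite -(eqmx_scale v a0) avX -mulNmx submxMl.
Qed.

(** * Arithmetic in F_2 *)

Lemma oppF2 (a : 'F_2) : - a = a.
Proof. exact/oppr_pchar2/pchar_Fp. Qed.

Lemma addF2K (a : 'F_2) : a + a = 0.
Proof. exact/addrr_pchar2/pchar_Fp. Qed.

Lemma F2_neq0 (a : 'F_2) : a != 0 -> a = 1.
Proof. by case: a => [[|[]]] //= i _; apply: val_inj. Qed.

Lemma mulF2K (a : 'F_2) : a * a = a.
Proof.
by have [->|/F2_neq0->] := eqVneq a 0; rewrite ?mul0r ?mulr1.
Qed.

Lemma natF2 (k : nat) : k%:R = (odd k)%:R :> 'F_2.
Proof. by rewrite -[k in LHS]odd_double_half natrD -addnn natrD addF2K addr0.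
  Qed.

(** * The matrix J - I over F_2 *)

Definition coid_mx r : 'M['F_2]_r := const_mx 1 - 1%:M.

Lemma coid_mxE r i j : coid_mx r i j = (i != j)%:R.
Proof. by rewrite !mxE; case: eqP => _; rewrite ?subrr ?subr0. Qed.

Lemma coid_mx_tr r : (coid_mx r)^T = coid_mx r.
Proof. by apply/matrixP=> i j; rewrite mxE !coid_mxE eq_sym. Qed.

(** Every column of J - I has r - 1 ones, so the all-ones vector is fixed for even r and killed for
    odd r. The parity term in the frame count comes from this. *)
Lemma mul_ones_coid_mx k r :
  (const_mx 1 : 'M_(k, r)) *m coid_mx r = const_mx (~~ odd r)%:R.
Proof.
rewrite mulmxBr mulmx1; apply/matrixP=> i j; rewrite !mxE.
under eq_bigr do rewrite !mxE mulr1.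
rewrite sumr_const card_ord (natF2 r).
by case: odd; rewrite /= ?mulr1n ?mulr0n ?subrr // sub0r oppF2.
Qed.

(** For even r, J (J - I) = J, so (J - I)(J - I) = J - (J - I) = I. *)
Lemma mul_coid_mx r : ~~ odd r -> coid_mx r *m coid_mx r = 1%:M.
Proof.
move=> r_even; rewrite {1}/coid_mx mulmxBl mul_ones_coid_mx r_even mul1mx.
by rewrite /coid_mx opprB addrC subrK.
Qed.

Lemma coid_mx_unit r : ~~ odd r -> coid_mx r \in unitmx.
Proof. by move/mul_coid_mx => /mulmx1_unit[]. Qed.

(** Squaring is the identity on F_2, so v J v^T, the square of the coordinate sum, equals the sum of
    the squares, which is v v^T. *)
Lemma coid_mx_alt r (v : 'rV_r) : v *m coid_mx r *m v^T = 0.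
Proof.
rewrite mulmxBr mulmx1 mulmxBl.
have -> : v *m (const_mx 1 : 'M_r) = const_mx (\sum_j v 0 j).
  by apply/matrixP=> i j; rewrite !mxE ord1; under eq_bigr do rewrite mxE mulr1.
apply/eqP; rewrite subr_eq0; apply/eqP/matrixP=> i j; rewrite !mxE !ord1.
under eq_bigr do rewrite !mxE; under [RHS]eq_bigr do rewrite !mxE mulF2K.
by rewrite -mulr_sumr mulF2K.
Qed.

Lemma coid_mx_block r :
  coid_mx (1 + r) = block_mx 0 (const_mx 1) (const_mx 1) (coid_mx r).
Proof.
apply/matrixP=> i j; rewrite coid_mxE.
case: (split_ordP i) => i' ->; case: (split_ordP j) => j' ->.
- by rewrite block_mxEul !ord1 eqxx mxE.
- by rewrite block_mxEur eq_lrshift mxE.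
- by rewrite block_mxEdl eq_rlshift mxE.
- by rewrite block_mxEdr eq_rshift coid_mxE.
Qed.

(** * Counting the isometries of J - I row by row *)

Section CountIsometries.
Variable m : nat.
Hypothesis m_even : ~~ odd m.

Definition coid_isometries : {set 'M['F_2]_m} :=
  [set A | A *m coid_mx m *m A^T == coid_mx m].

(** Independence is a separate condition because J - I is singular for odd r: for r = 1 the zero row
    satisfies the Gram condition. *)
Definition coid_frames r : {set 'M['F_2]_(r, m)} :=
  [set X | row_free X && (X *m coid_mx m *m X^T == coid_mx r)].

(** The form is alternating, so the new diagonal entry is automatically 0; by symmetry only the
    pairings with the old rows remain. *)
Lemma col_mx_coid_frames r (v : 'rV_m) (X : 'M_(r, m)) :
  (col_mx v X \in coid_frames (1 + r)) =
  [&& X \in coid_frames r, v *m (coid_mx m *m X^T) == const_mx 1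
    & ~~ (v <= X)%MS].
Proof.
rewrite !inE row_free_col_mx1 tr_col_mx mul_col_mx mul_col_row coid_mx_alt.
rewrite coid_mx_block -mulmxA.
have -> : X *m coid_mx m *m v^T = (v *m (coid_mx m *m X^T))^T.
  by rewrite !trmx_mul trmxK coid_mx_tr.
rewrite -!andbA; case: (row_free X) => //=; rewrite andbC [RHS]andbA.
congr (_ && _); apply/eqP/andP => [/eq_block_mx[_ -> _ ->] | [/eqP-> /eqP->]].
  by [].
by rewrite trmx_const.
Qed.

(** The pairing conditions form a system of full rank with 2^(m-r) solutions. A solution in the span
    of X is a X with a (J - I) all-ones: impossible for odd r, and only the all-ones a for even
    r. *)
Lemma card_coid_frame_ext r (X : 'M_(r, m)) : X \in coid_frames r ->
  #|[set v : 'rV_m | (v *m (coid_mx m *m X^T) == const_mx 1)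
                      && ~~ (v <= X)%MS]| = (2 ^ (m - r) - ~~ odd r)%N.
Proof.
rewrite inE => /andP[fX /eqP gX].
have Mfull : row_full (coid_mx m *m X^T).
  by rewrite /row_full eqmxMfull ?mxrank_tr // row_full_unit coid_mx_unit.
set S := [set v : 'rV_m | v *m (coid_mx m *m X^T) == const_mx 1].
have -> : [set v : 'rV_m | (v *m (coid_mx m *m X^T) == const_mx 1)
                           && ~~ (v <= X)%MS]
        = S :\: (S :&: [set v | (v <= X)%MS]).
  by apply/setP=> v; rewrite !inE; case: eqP; rewrite //= andbT.
rewrite cardsD setIA setIid card_mulmx_eq // card_Fp //; congr (_ - _)%N.
have vX (a : 'rV_r) : (a *m X \in S) = (a *m coid_mx r == const_mx 1).
  by rewrite inE -mulmxA (mulmxA X) gX.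
have [r_odd | r_even] := boolP (odd r).
  apply/eqP; rewrite cards_eq0 -subset0; apply/subsetP=> v /setIP[Sv].
  rewrite inE => /submxP[a va]; move: Sv; rewrite va vX.
  (* Multiplying by the all-ones column kills the left side and gives r = 1 on the right. *)
  move/eqP/(congr1 (mulmx^~ (const_mx 1 : 'cV_r))).
  have -> : a *m coid_mx r *m (const_mx 1 : 'cV_r) = 0.
    rewrite -mulmxA -[coid_mx r]coid_mx_tr -[const_mx 1]trmx_const -trmx_mul.
    by rewrite mul_ones_coid_mx r_odd trmx_const (_ : const_mx _ = 0) ?mulmx0.
  move/matrixP/(_ 0 0); rewrite !mxE.
  under eq_bigr do rewrite !mxE mulr1.
  by rewrite sumr_const card_ord natF2 r_odd.
have -> : S :&: [set v | (v <= X)%MS] = [set const_mx 1 *m X].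
  apply/setP=> v; rewrite in_set1; apply/setIP/eqP => [[Sv] | ->]; last first.
    by rewrite vX mul_ones_coid_mx r_even inE submxMl.
  rewrite inE => /submxP[a va]; move: Sv;
    rewrite va vX => /eqP/(congr1 (mulmx^~ (coid_mx r))).
  by rewrite -mulmxA mul_coid_mx // mulmx1 mul_ones_coid_mx r_even => ->.
by rewrite cards1.
Qed.

Lemma card_coid_frames r :
  #|coid_frames r| = (\prod_(i < r) (2 ^ (m - i) - ~~ odd i))%N.
Proof.
elim: r => [|r IHr].
  rewrite big_ord0; apply/eqP/cards1P; exists 0; apply/setP=> X.
  rewrite !inE (flatmx0 X) eqxx; apply/andP; split;
    first by rewrite /row_free mxrank0.
  by apply/eqP/matrixP=> -[].
rewrite big_ord_recr /= -IHr -[LHS]/#|coid_frames (1 + r)| -[LHS]sum1_card.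
rewrite (reindex (fun p : 'M_(r, m) * 'rV_m => col_mx p.2 p.1 : 'M_(1 + r,
  m))) /=; last first.
  exists (fun X : 'M_(1 + r, m) => (dsubmx X, usubmx X)) => [[X v] | X] _ /=.
    by rewrite col_mxKd col_mxKu.
  by rewrite vsubmxK.
under eq_bigl do rewrite col_mx_coid_frames.
rewrite -(pair_big_dep (mem (coid_frames r)) (fun X v => (v *m (coid_mx m *m
  X^T) == const_mx 1)
                      && ~~ (v <= X)%MS) (fun _ _ => 1%N)) /=.
rewrite -sum_nat_const; apply: eq_bigr => X /card_coid_frame_ext <-.
by rewrite sum1dep_card.
Qed.

Lemma card_coid_isometries : #|coid_isometries| =
  (\prod_(1 <= k < (m %/ 2).+1) ((2 ^ (2 * k) - 1) * 2 ^ (2 * k - 1)))%N.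
Proof.
(* For even m the Gram matrix is invertible, which forces A to be invertible. *)
have -> : coid_isometries = coid_frames m.
  apply/setP=> A; rewrite !inE andb_idl // => /eqP gA.
  rewrite row_free_unit; apply: contraLR (coid_mx_unit m_even).
  by rewrite -gA !unitmx_mul => /negPf->.
rewrite card_coid_frames divn2.
have mE : m = m./2.*2 by rewrite -[LHS]odd_double_half (negPf m_even).
(* Counted from the end, the factors are 2^(i+1) - odd i since m is even; those for i = 2k-2 and i =
   2k-1 combine into factor k of the target. *)
rewrite (reindex_inj rev_ord_inj) /=.
transitivity (\prod_(i < m) (2 ^ i.+1 - odd i))%N.
  apply: eq_bigr => i _; rewrite subKn // oddB // (negPf m_even) /=.
  by rewrite negbK.
rewrite -(big_mkord xpredT (fun i => 2 ^ i.+1 - odd i)%N) {1}mE.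
elim: m./2 => [|k IHk]; first by rewrite !big_nil.
rewrite [RHS]big_nat_recr //= -IHk doubleS !big_nat_recr //= odd_double /=.
by rewrite subn0 mul2n doubleS subn1 mulnAC mulnA.
Qed.
End CountIsometries.

(** * The standard bilinear form and the alternating form of J - I *)

Definition dotF2 m (x y : 'rV['F_2]_m) : 'F_2 := (x *m y^T) 0 0.

(** This will be the polar form of the weight function [wt_quad]. *)
Definition cdotF2 m (x y : 'rV['F_2]_m) : 'F_2 := dotF2 (x *m coid_mx m) y.

Lemma dotF2E m (x y : 'rV_m) : dotF2 x y = \sum_j x 0 j * y 0 j.
Proof. by rewrite /dotF2 mxE; apply: eq_bigr => j _; rewrite mxE. Qed.

Lemma dotF2C m (x y : 'rV_m) : dotF2 x y = dotF2 y x.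
Proof. by rewrite !dotF2E; apply: eq_bigr => j _; rewrite mulrC. Qed.

Lemma dotF2Dl m (x y z : 'rV_m) : dotF2 (x + y) z = dotF2 x z + dotF2 y z.
Proof. by rewrite /dotF2 mulmxDl mxE. Qed.

Lemma dot0F2 m (x : 'rV_m) : dotF2 0 x = 0.
Proof. by rewrite /dotF2 mul0mx mxE. Qed.

Lemma dotF2_mulmxr m (x y : 'rV_m) (A : 'M_m) :
  dotF2 x (y *m A) = dotF2 (x *m A^T) y.
Proof. by rewrite /dotF2 trmx_mul mulmxA. Qed.

Lemma cdotF2C m (x y : 'rV_m) : cdotF2 x y = cdotF2 y x.
Proof. by rewrite /cdotF2 dotF2C dotF2_mulmxr coid_mx_tr. Qed.

Lemma cdotF2Dl m (x y z : 'rV_m) : cdotF2 (x + y) z = cdotF2 x z + cdotF2 y z.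
Proof. by rewrite /cdotF2 mulmxDl dotF2Dl. Qed.

Lemma cdotF2xx m (x : 'rV_m) : cdotF2 x x = 0.
Proof. by rewrite /cdotF2 /dotF2 coid_mx_alt mxE. Qed.

(** Over F_2 additivity is linearity, the only scalars being 0 and 1; [k] lists the values of [g] on
    the basis vectors. *)
Lemma additive_dotF2 m (g : 'rV['F_2]_m -> 'F_2) :
  {morph g : x y / x + y} -> exists k, forall x, g x = dotF2 x k.
Proof.
move=> gD; have g0 : g 0 = 0 by apply: (addrI (g 0)); rewrite -gD !addr0.
exists (\row_j g (delta_mx 0 j)) => x; rewrite dotF2E {1}[x]row_sum_delta.
rewrite (big_morph g gD g0); apply: eq_bigr => j _; rewrite mxE.
by have [->|/F2_neq0->] := eqVneq (x 0 j) 0;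
  rewrite ?scale0r ?mul0r ?scale1r ?mul1r.
Qed.

Lemma F2_natE (a : 'F_2) : a = (a != 0)%:R.
Proof. by have [->|/F2_neq0] := eqVneq a 0. Qed.

Lemma natF2_bool (b c : bool) : b%:R + c%:R = (b (+) c)%:R :> 'F_2.
Proof. by case: b; case: c => //=; rewrite ?addr0 ?add0r ?addF2K. Qed.

(** * Hamming weights mod 4 as a quadratic form *)

(** Here [a], [b], [c], [d] stand for the weights of x, of y, of their common support and of x + y.
    The hypotheses leave {1, 2} or {2, 3} for the indices, and only [a] and [b] mod 4 and [c] mod 2
    matter, so finitely many cases remain. *)
Lemma mod4_digits (i1 i2 : 'I_4) a b c d :
    odd (i1 + i2) -> (0 < i1)%N -> (0 < i2)%N -> (d + 2 * c = a + b)%N ->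
  let phi k := (k == i1 %[mod 4]) || (k == i2 %[mod 4]) in
  phi d = phi a (+) phi b (+) (odd a && odd b (+) odd c).
Proof.
move=> i12 i10 i20 dE /=.
have -> : (d %% 4 = (a %% 4 + b %% 4 + 2 * (c %% 2)) %% 4)%N by lia.
rewrite -(@odd_mod a 4) // -(@odd_mod b 4) // -(@odd_mod c 2) //.
move: (ltn_pmod a (isT : 0 < 4)%N) (ltn_pmod b (isT : 0 < 4)%N) (ltn_pmod c
  (isT : 0 < 2)%N).
move: (a %% 4)%N (b %% 4)%N (c %% 2)%N => {a b c d dE} a b c.
case: i1 i12 i10 => [[|[|[|[|[]]]]]] //= ? + _;
  case: i2 i20 => [[|[|[|[|[]]]]]] //= ? _ _;
case: a => [|[|[|[|[]]]]] //; case: b => [|[|[|[|[]]]]] //;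
  by case: c => [|[|[]]].
Qed.

Section HammingWeight.
Variable m : nat.
Implicit Types x y : 'rV['F_2]_m.

Definition common_support x y := #|[set j | (x 0 j != 0) && (y 0 j != 0)]|.

Lemma hwt_sum x : hwt x^T = (\sum_j (x 0%R j != 0%R))%N.
Proof.
by rewrite /hwt -sum1dep_card big_mkcond; apply: eq_bigr => j _; rewrite mxE;
  case: eqP.
Qed.

Lemma common_support_sum x y :
  common_support x y = (\sum_j (x 0%R j != 0%R) && (y 0%R j != 0%R))%N.
Proof.
by rewrite /common_support -sum1dep_card big_mkcond; apply: eq_bigr => j _;
  case: ifP.
Qed.

Lemma hwtD x y :
  (hwt (x + y)^T + 2 * common_support x y = hwt x^T + hwt y^T)%N.
Proof.
rewrite !hwt_sum common_support_sum big_distrr -!big_split.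
apply: eq_bigr => j _; rewrite mxE /=.
have [->|/F2_neq0->] := eqVneq (x 0 j) 0; first by rewrite add0r /= muln0 addn0.
have [->|/F2_neq0->] := eqVneq (y 0 j) 0; first by rewrite addr0.
by rewrite addF2K.
Qed.

(** x J y^T is the product of the coordinate sums, which are the weights mod 2, and x y^T counts the
    common support. *)
Lemma cdotF2_hwt x y :
  cdotF2 x y = (hwt x^T * hwt y^T)%:R + (common_support x y)%:R.
Proof.
have sumE (z : 'rV_m) : \sum_j z 0 j = (hwt z^T)%:R :> 'F_2.
  by rewrite hwt_sum natr_sum; apply: eq_bigr => j _; apply: F2_natE.
rewrite /cdotF2 /coid_mx mulmxBr mulmx1 dotF2E.
under eq_bigr do rewrite !mxE mulrDl mulNr oppF2.
rewrite big_split natrM -!sumE mulr_sumr; congr (_ + _).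
  by apply: eq_bigr => j _; under eq_bigr do rewrite mxE mulr1.
rewrite common_support_sum natr_sum.
apply: eq_bigr => j _; have [->|/F2_neq0->] := eqVneq (x 0 j) 0;
  first exact: mul0r.
by have [->|/F2_neq0->] := eqVneq (y 0 j) 0; rewrite mul1r.
Qed.

(** The appended parity check row, read as a function on all of F_2^m, the zero vector included. *)
Definition wt_quad (i1 i2 : nat) x : 'F_2 :=
  ((hwt x^T == i1 %[mod 4]) || (hwt x^T == i2 %[mod 4]))%:R.

Lemma wt_quad0 (i1 i2 : 'I_4) : (0 < i1)%N -> (0 < i2)%N -> wt_quad i1 i2 0 = 0.
Proof.
move=> i10 i20; have hwt0 : hwt (0 : 'rV['F_2]_m)^T = 0%N.
  by rewrite hwt_sum big1 // => j _; rewrite mxE eqxx.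
rewrite /wt_quad hwt0 mod0n !modn_small ?ltn_ord //.
by rewrite !ltn_eqF.
Qed.

(* The second binary digit of the weight is the quadratic form
   [\sum_(i < j) x_i x_j], and the first one is a linear form. *)
Lemma wt_quadD (i1 i2 : 'I_4) x y : odd (i1 + i2) -> (0 < i1)%N -> (0 < i2)%N ->
  wt_quad i1 i2 (x + y) = wt_quad i1 i2 x + wt_quad i1 i2 y + cdotF2 x y.
Proof.
move=> i12 i10 i20; rewrite cdotF2_hwt natF2 (natF2 (common_support _ _)) oddM.
rewrite /wt_quad !natF2_bool; congr (_%:R); congr nat_of_bool.
exact: mod4_digits (hwtD x y).
Qed.

End HammingWeight.

(** * Character sums: linear forms are balanced, quadratic ones are bent *)

Section CharacterSums.
Variable m : nat.
Hypothesis m_even : ~~ odd m.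

Definition sgnF2 (a : 'F_2) : int := (-1) ^+ (a != 0).

Lemma sgnF2D a b : sgnF2 (a + b) = sgnF2 a * sgnF2 b.
Proof.
rewrite /sgnF2 -signr_addb; congr (_ ^+ nat_of_bool _).
by rewrite [a in LHS]F2_natE [b in LHS]F2_natE natF2_bool; case: (_ (+) _).
Qed.

(** Adding a basis vector on which the linear form is 1 flips the sign of every term, so the sum
    equals its own opposite. *)
Lemma sum_sgnF2_dot (l : 'rV_m) : l != 0 -> \sum_x sgnF2 (dotF2 x l) = 0.
Proof.
case/rV0Pn => j lj; set S := \sum_x _.
have SN : S = - S.
  rewrite {1}/S (reindex_inj (addrI (delta_mx 0 j))) /= -mulN1r mulr_sumr.
  apply: eq_bigr => x _; rewrite dotF2Dl sgnF2D; congr (_ * _).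
  rewrite dotF2E (bigD1 j) //= mxE !eqxx mul1r big1 ?addr0 => [|i ij].
    by rewrite /sgnF2 lj.
  by rewrite mxE (negPf ij) andbF mul0r.
by move/eqP: SN; rewrite -addr_eq0 -mulr2n mulrn_eq0 /= => /eqP.
Qed.

(* Squaring and substituting [y = x + z], the inner sum over [x] vanishes unless
   [z = 0]. *)
Lemma sum_sgnF2_quad (f : 'rV_m -> 'F_2) :
  (forall x y, f (x + y) = f x + f y + f 0 + cdotF2 x y) ->
  (\sum_x sgnF2 (f x)) ^+ 2 = (2 ^ m)%:R.
Proof.
move=> fD; rewrite expr2 mulr_suml.
transitivity (\sum_z sgnF2 (f z + f 0) * \sum_x sgnF2 (cdotF2 x z)).
  under [RHS]eq_bigr do rewrite mulr_sumr.
  rewrite [RHS]exchange_big /=; apply: eq_bigr => x _.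
  rewrite (reindex_inj (addrI x)) mulr_sumr; apply: eq_bigr => z _.
  by rewrite -!sgnF2D fD !addrA addF2K add0r.
rewrite (bigD1 0) //= [X in _ + X]big1 => [|z z0].
  rewrite addr0 addF2K (_ : sgnF2 0 = 1) // mul1r;
    under eq_bigr do rewrite cdotF2C /cdotF2 mul0mx dot0F2.
  by rewrite sumr_const card_mx card_Fp // mul1n.
under eq_bigr do rewrite cdotF2C /cdotF2 dotF2C.
rewrite sum_sgnF2_dot ?mulr0 //; apply: contraNneq z0.
move/(congr1 (mulmx^~ (coid_mx m))).
by rewrite -mulmxA mul_coid_mx // mulmx1 mul0mx => ->.
Qed.

End CharacterSums.

(** * Code automorphisms as affine isometries *)

(** A permutation preserves a code iff it preserves the dual, here the row space of H. Passing to
    the inverse, which the group structure permits, moves the action from the word to H. *)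
Lemma code_aut_pcm r n (H : 'M['F_2]_(r, n)) s :
  (s \in code_aut (code_of_pcm H)) = (col_perm s H <= H)%MS.
Proof.
have col_permV (x : 'rV['F_2]_n) :
    (H *m (col_perm s^-1 x)^T == 0) = (col_perm s H *m x^T == 0).
  by rewrite tr_col_perm row_permE col_permE mulmxA.
apply/idP/idP => [|/submxP[U UH]].
  rewrite -groupV inE => /forall_inP sC; rewrite submxE;
    apply/eqP/matrixP=> i j.
  (* The columns of the cokernel matrix are codewords, and together they detect membership in the
     row space. *)
  have /sC : (col j (cokermx H))^T \in code_of_pcm H.
    by rewrite inE trmxK colE mulmxA mulmx_coker mul0mx.
  rewrite inE col_permV trmxK colE mulmxA -colE => /eqP/matrixP/(_ i 0).
  by rewrite !mxE.
rewrite -groupV inE; apply/forall_inP => c; rewrite !inE col_permV UH -mulmxA.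
by move/eqP->; rewrite mulmx0.
Qed.

Section AffineAut.
Variables (m N : nat) (e : 'I_N -> 'rV['F_2]_m) (q : 'rV['F_2]_m -> 'F_2).
Hypothesis m_even : ~~ odd m.
Hypothesis m_gt0 : (0 < m)%N.
Hypothesis e_bij : bijective e.
Hypothesis qD : forall x y, q (x + y) = q x + q y + cdotF2 x y.

Definition quad_pcm : 'M['F_2]_(1 + m + 1, N) :=
  col_mx (col_mx (const_mx 1) (\matrix_(j, i) e i 0 j)) (\row_i q (e i)).

Lemma quad_pcmP (w : 'rV_N) :
  reflect (exists a k b, forall i, w 0 i = a + dotF2 (e i) k + b * q (e i))
          (w <= quad_pcm)%MS.
Proof.
have mulE (a b : 'M_1) (k : 'rV_m) i :
    (row_mx (row_mx a k) b *m quad_pcm) 0 i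
      = a 0 0 + dotF2 (e i) k + b 0 0 * q (e i).
  rewrite !mul_row_col !mxE !big_ord1 !mxE mulr1; congr (_ + _ + _).
  by rewrite dotF2C dotF2E; apply: eq_bigr => j _; rewrite mxE.
apply: (iffP submxP) => [[U wU] | [a [k [b wE]]]].
  rewrite -[U]hsubmxK -[lsubmx U]hsubmxK in wU.
  by do 3!eexists; move=> i; rewrite wU mulE.
exists (row_mx (row_mx a%:M k) b%:M); apply/rowP => i.
by rewrite mulE wE !mxE !mulr1n.
Qed.

Lemma quad_pcm_const i j : quad_pcm (lshift 1 (lshift m j)) i = 1.
Proof. by rewrite /quad_pcm col_mxEu col_mxEu mxE. Qed.

Lemma quad_pcm_coord i j : quad_pcm (lshift 1 (rshift 1 j)) i = e i 0 j.
Proof. by rewrite /quad_pcm col_mxEu col_mxEd mxE. Qed.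

Lemma quad_pcm_quad i j : quad_pcm (rshift (1 + m) j) i = q (e i).
Proof. by rewrite /quad_pcm col_mxEd mxE. Qed.

Let q0 : q 0 = 0.
Proof. by have := qD 0 0; rewrite cdotF2xx !addr0 addF2K. Qed.

(** The factor [c] allows for a similitude; for automorphisms it is later shown to be 1. *)
Lemma cdotF2_isometryP (A : 'M_m) c :
  (forall x y, cdotF2 (x *m A) (y *m A) = c * cdotF2 x y) ->
  A *m coid_mx m *m A^T = c *: coid_mx m.
Proof.
move=> gA; apply/matrixP=> i j.
have := gA (delta_mx 0 i) (delta_mx 0 j).
rewrite /cdotF2 dotF2_mulmxr /dotF2 !trmx_delta -!(mulmxA (delta_mx 0 i)).
by rewrite -!colE -!rowE !mxE.
Qed.

Lemma isometry_cdotF2 (A : 'M_m) x y :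
  A \in coid_isometries m -> cdotF2 (x *m A) (y *m A) = cdotF2 x y.
Proof.
by rewrite inE => /eqP gA; rewrite /cdotF2 dotF2_mulmxr -!(mulmxA x) gA.
Qed.

Lemma quad_pcm_aut_affine s : s \in code_aut (code_of_pcm quad_pcm) ->
  exists A b, forall i, e (s i) = e i *m A + b.
Proof.
have [d eK dK] := e_bij; rewrite code_aut_pcm => sH.
(* Coordinate [j] of [e (s i)], as a function of [i], lies in the row space; the coefficient 1 of
   [q] has to be excluded. *)
have coordP j : exists ak, forall i, e (s i) 0 j = ak.1 + dotF2 (e i) ak.2.
  have : ((\row_i e (s i) 0 j : 'rV_N) <= quad_pcm)%MS.
    apply: submx_trans sH.
    have -> : \row_i e (s i) 0 j = row (lshift 1 (rshift 1 j)) (col_perm s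
      quad_pcm).
      by apply/rowP=> i; rewrite 3!mxE quad_pcm_coord.
    exact: row_sub.
  case/quad_pcmP=> a [k [b abk]]; exists (a, k) => i /=.
  move: (abk i); rewrite mxE => ->.
  have [->|/F2_neq0 b1] := eqVneq b 0; first by rewrite mul0r addr0.
  (* With b = 1, the character sum of [f] has square 2^m. But [f (e i)] is coordinate [j] of
     [e (s i)], a rearrangement of a nonzero linear form, whose sum is 0. *)
  pose f x := a + dotF2 x k + q x.
  have fD x y : f (x + y) = f x + f y + f 0 + cdotF2 x y.
    rewrite /f qD dotF2Dl q0 dot0F2 !addr0.
    by rewrite -[LHS]addr0 -(addF2K a); ring.
  have : \sum_x sgnF2 (f x) = \sum_x sgnF2 (dotF2 x (delta_mx 0 j)).
    rewrite [LHS](reindex e) /=; last by apply: onW_bij.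
    rewrite [RHS](reindex e) /=; last by apply: onW_bij.
    rewrite [RHS](reindex_inj (@perm_inj _ s)); apply: eq_bigr => i' _;
      congr sgnF2.
    move: (abk i'); rewrite b1 mul1r mxE /f => <-.
    by rewrite /dotF2 trmx_delta -colE mxE.
  rewrite sum_sgnF2_dot => [S0|]; last first.
    by apply/rV0Pn; exists j; rewrite mxE !eqxx.
  move: (sum_sgnF2_quad m_even fD); rewrite S0 expr0n /= => /esym/eqP.
  by rewrite pnatr_eq0 expn_eq0.
have [ak akP] := fin_all_exists coordP.
exists (\matrix_(l, j) (ak j).2 0 l), (\row_j (ak j).1) => i.
apply/rowP=> j; rewrite akP !mxE addrC dotF2E; congr (_ + _).
by apply: eq_bigr => l _; rewrite mxE.
Qed.

Lemma quad_pcm_autP (s : 'S_N) :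
  reflect (exists2 A, A \in coid_isometries m
             & exists b, forall i, e (s i) = e i *m A + b)
          (s \in code_aut (code_of_pcm quad_pcm)).
Proof.
apply: (iffP idP) => [sC | [A isoA [b sA]]]; case: (e_bij) => d eK dK.
  have [A [b sA]] := quad_pcm_aut_affine sC.
  exists A; last by exists b.
  have A_unit : A \in unitmx.
    rewrite -row_free_unit; apply: inj_row_free => x xA.
    have : e (s (d x)) = e (s (d 0)) by rewrite !sA !dK xA mul0mx.
    by move/(can_inj eK)/perm_inj/(can_inj dK).
  have : ((\row_i q (e (s i)) : 'rV_N) <= quad_pcm)%MS.
    rewrite code_aut_pcm in sC; apply: submx_trans sC.
    have -> : \row_i q (e (s i)) = row (rshift (1 + m) 0) (col_perm s quad_pcm).
      by apply/rowP=> i; rewrite 3!mxE quad_pcm_quad.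
    exact: row_sub.
  case/quad_pcmP=> a [k [c ack]].
  (* Polarising this identity will show that A multiplies the form by [c]. *)
  have qA x : q (x *m A + b) = a + dotF2 x k + c * q x.
    by move: (ack (d x)); rewrite mxE sA dK.
  have gA x y : cdotF2 (x *m A) (y *m A) = c * cdotF2 x y.
    have qb : q b = a by have := qA 0;
      rewrite mul0mx add0r q0 dot0F2 mulr0 !addr0.
    have qyA : q (y *m A) + cdotF2 b (y *m A) = dotF2 y k + c * q y.
      by apply: (addrI a); rewrite [RHS]addrA -qA qD qb cdotF2C; ring.
    have := qA (x + y).
    rewrite mulmxDl addrAC qD cdotF2Dl qA dotF2Dl qD => qxyA.
    apply: (addrI (a + dotF2 x k + c * q x + (dotF2 y k + c * q y))).
    by rewrite -{1}qyA;
      transitivity (a + (dotF2 x k + dotF2 y k) + c * (q x + q y + cdotF2 x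
        y)); [rewrite -qxyA; ring | ring].
  move/cdotF2_isometryP: gA.
  have [-> | /F2_neq0->] := eqVneq c 0; last by rewrite scale1r inE => ->.
  (* With c = 0 an invertible matrix would vanish, impossible in positive dimension. *)
  rewrite scale0r => A0; have : A *m coid_mx m *m A^T \in unitmx.
    by rewrite !unitmx_mul unitmx_tr A_unit coid_mx_unit.
  by move/mxrank_unit; rewrite A0 mxrank0 => m0; case/negP: (lt0n_neq0 m_gt0);
    rewrite -m0.
(* Conversely, for an isometry A, q (x A) and q x have the same polar form, so their sum is additive
   and hence a linear form. *)
have [k kP] : exists k, forall x, q (x *m A) + q x = dotF2 x k.
  apply: additive_dotF2 => x y; rewrite mulmxDl !qD isometry_cdotF2 //.
  by rewrite -[RHS]addr0 -(addF2K (cdotF2 x y)); ring.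
rewrite code_aut_pcm; apply/row_subP=> j.
rewrite -[j]splitK; case: (split j) => [j'|j'] /=; last first.
  (* Expand q (x A + b) as q (x A) + q b + [cdotF2] of x A and b; the last term is the linear form
     with coefficient vector b (J - I) A^T. *)
  apply/quad_pcmP; exists (q b), (k + b *m coid_mx m *m A^T), 1 => i.
  rewrite 2!mxE quad_pcm_quad sA qD -[q (_ *m A)](addrK (q (e i))) kP oppF2.
  rewrite [dotF2 _ (k + _)]dotF2C dotF2Dl -dotF2_mulmxr -/(cdotF2 _ _) cdotF2C.
  by rewrite [dotF2 k _]dotF2C; ring.
rewrite -[j']splitK; case: (split j') => [j''|j''] /=.
  apply/quad_pcmP; exists 1, 0, 0 => i.
  by rewrite 2!mxE quad_pcm_const dotF2C dot0F2 mul0r !addr0.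
apply/quad_pcmP; exists (b 0 j''), (col j'' A)^T, 0 => i.
rewrite 2!mxE quad_pcm_coord sA mxE mul0r addr0 addrC; congr (_ + _).
by rewrite /dotF2 trmxK colE mulmxA -colE !mxE.
Qed.

End AffineAut.

(** * Order and semidirect structure of the affine group *)

Section AutStructure.
Variables (m N : nat) (e : 'I_N -> 'rV['F_2]_m) (q : 'rV['F_2]_m -> 'F_2).
Hypothesis m_even : ~~ odd m.
Hypothesis m_gt0 : (0 < m)%N.
Hypothesis e_bij : bijective e.
Hypothesis qD : forall x y, q (x + y) = q x + q y + cdotF2 x y.

Let G := code_aut_group (code_of_pcm (quad_pcm e q)).

Let autP s := @quad_pcm_autP m N e q m_even m_gt0 e_bij qD s.

Lemma isometry_unit (A : 'M_m) : A \in coid_isometries m -> A \in unitmx.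
Proof.
rewrite inE => /eqP gA; have := coid_mx_unit m_even.
by rewrite -gA !unitmx_mul => /andP[/andP[]].
Qed.

Lemma isometry1 : 1%:M \in coid_isometries m.
Proof. by rewrite inE trmx1 mul1mx mulmx1. Qed.

(* The identity when no such permutation exists, i.e., when [p.1] is singular.
  *)
Definition aff_perm (p : 'M['F_2]_m * 'rV['F_2]_m) : 'S_N :=
  odflt 1%g [pick s : 'S_N | [forall i, e (s i) == e i *m p.1 + p.2]].

Lemma aff_permE A b i : A \in coid_isometries m ->
  e (aff_perm (A, b) i) = e i *m A + b.
Proof.
move=> /isometry_unit uA; rewrite /aff_perm;
  case: pickP => [s /forallP/(_ i)/eqP // | no_s].
have [d eK dK] := e_bij.
have f_inj : injective (fun j => d (e j *m A + b)).
  move=> j k /(can_inj dK)/addIr/(can_inj (mulmxK uA)); exact: can_inj.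
have /forallP[] := no_s (perm f_inj).
by move=> j; rewrite permE dK.
Qed.

Lemma code_aut_aff_perm : G = [set aff_perm p | p in setX (coid_isometries m)
  setT] :> {set _}.
Proof.
apply/setP=> s; apply/idP/imsetP => [/autP[A isoA [b sA]] | [[A b]]].
  exists (A, b); first by rewrite !inE andbT -[_ == _]inE in isoA *.
  by apply/permP=> i; apply: (bij_inj e_bij); rewrite aff_permE.
case/setXP => isoA _ ->; apply/autP; exists A => //; exists b => i.
exact: aff_permE.
Qed.

Lemma card_quad_pcm_aut : #|G| = (#|coid_isometries m| * 2 ^ m)%N.
Proof.
rewrite code_aut_aff_perm card_in_imset; last first.
  move=> [A b] [A' b'] /setXP[isoA _] /setXP[isoA' _] /permP eqAb.
  (* The value at 0 determines the translation part, and then the basis vectors determine the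
     matrix. *)
  have {}eqAb x : x *m A + b = x *m A' + b'.
    by have [d _ dK] := e_bij; rewrite -(dK x) -!aff_permE // eqAb.
  have eqb : b = b' by have := eqAb 0; rewrite !mul0mx !add0r.
  congr (_, _) => //; apply/row_matrixP => i; rewrite !rowE.
  by have := eqAb (delta_mx 0 i); rewrite eqb => /addIr.
by rewrite cardsX cardsT card_mx card_Fp // mul1n.
Qed.

Definition transl (b : 'rV['F_2]_m) : 'S_N := aff_perm (1%:M, b).

Lemma translE b i : e (transl b i) = e i + b.
Proof. by rewrite aff_permE ?isometry1 // mulmx1. Qed.

Lemma translM : {in [set: 'rV['F_2]_m] &, {morph transl : b c / (b * c)%g}}.
Proof.
move=> b c _ _; apply/permP=> i; apply: (bij_inj e_bij).
by rewrite permM !translE addrA.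
Qed.

Canonical transl_morphism := Morphism translM.

Lemma transl_inj : injective transl.
Proof.
move=> b c; have [d _ dK] := e_bij => /permP/(_ (d 0))/(congr1 e).
by rewrite !translE dK !add0r.
Qed.

Lemma transl_isog : (transl @* [set: 'rV['F_2]_m])%g \isog [set: 'rV['F_2]_m].
Proof.
rewrite isog_sym sub_isog //; apply/injmP=> b c _ _; exact: transl_inj.
Qed.

Lemma mem_transl s :
  reflect (exists b, s = transl b) (s \in (transl @* [set: 'rV['F_2]_m])%g).
Proof.
apply: (iffP morphimP) => [[b _ _ ->] | [b ->]]; first by exists b.
by exists b; rewrite ?inE.
Qed.

Lemma transl_sdprod i0 : e i0 = 0 ->
  (transl @* [set: 'rV['F_2]_m] ><| 'C_G[i0 | 'P] = G)%g.
Proof.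
move=> ei0.
have tG b : transl b \in G.
  by apply/autP; exists 1%:M; [exact: isometry1 | exists b => i;
    rewrite translE mulmx1].
have nK : (G \subset 'N(transl @* [set: 'rV['F_2]_m]))%g.
  (* Conjugating the translation by b with x -> x A + c gives the translation by b A. *)
  apply/subsetP=> s /autP[A isoA [c sA]]; rewrite inE; apply/subsetP=> t.
  case/imsetP=> _ /mem_transl[b ->] ->; apply/mem_transl; exists (b *m A).
  rewrite conjgE; apply/permP=> i; apply: (bij_inj e_bij).
  rewrite !permM sA !translE mulmxDl addrAC -sA.
  by rewrite -permM mulVg perm1.
rewrite sdprodE.
- apply/eqP; rewrite eqEsubset mul_subG ?subsetIl //=; last first.
    by apply/subsetP=> _ /mem_transl[b ->]; apply: tG.
  rewrite -normC; last by apply: subset_trans nK; apply: subsetIl.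
  (* The translation by [e (s i0)] sends [i0] to [s i0], so [s] followed by its inverse fixes
     [i0]. *)
  apply/subsetP=> s sG;
    have sE : (s = s * (transl (e (s i0)))^-1 * transl (e (s i0)))%g.
    by rewrite mulgKV.
  rewrite sE mem_mulg //; last by apply/mem_transl; eexists.
  rewrite inE groupM ?groupV ?tG //=; apply/astab1P.
  rewrite /= /aperm permM.
  apply: (canLR (permK _)); apply: (bij_inj e_bij).
  by rewrite translE ei0 add0r.
- by apply: subset_trans nK; apply: subsetIl.
- apply/trivgP/subsetP=> _ /setIP[/mem_transl[b ->] /setIP[_ /astab1P]].
  move/(congr1 e); rewrite translE ei0 add0r => ->.
  by rewrite (_ : transl 0 = 1%g) ?inE //; exact: (morph1 transl_morphism).
Qed.

End AutStructure.

(** * The stabiliser of the parity coordinate in an extended code *)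

Lemma mem_ext_code n (C : {set 'rV['F_2]_n}) p c :
  (row_mx p c \in ext_code C) = (p == (\sum_i c 0 i)%:M) && (c \in C).
Proof.
apply/imsetP/andP => [[c' Cc' /eq_row_mx[-> ->]] | [/eqP-> Cc]]; first by [].
by exists c.
Qed.

Lemma col_perm_lift0 n (s : 'S_n) (p : 'M['F_2]_1) (c : 'rV_n) :
  col_perm (lift_perm ord0 ord0 s : 'S_(1 + n)) (row_mx p c) = row_mx p
    (col_perm s c).
Proof.
apply/rowP=> j; rewrite mxE; case: (split_ordP j) => k ->.
  have -> : lshift n k = ord0 by apply: val_inj; rewrite /= ord1.
  by rewrite (lift_perm_id ord0 ord0 s) -[ord0](lshift0 n 0) !row_mxEl.
rewrite row_mxEr [RHS]mxE.
have rshiftE (k' : 'I_n) : rshift 1 k' = lift ord0 k' by apply: val_inj.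
by rewrite !rshiftE (lift_perm_lift ord0 ord0 s k) -rshiftE row_mxEr.
Qed.

Lemma lift_perm0_ext_aut n (C : {set 'rV['F_2]_n}) (s : 'S_n) :
  ((lift_perm ord0 ord0 s : 'S_(1 + n)) \in code_aut (ext_code C)) = (s \in
    code_aut C).
Proof.
have sumE (c : 'rV['F_2]_n) : \sum_i col_perm s c 0 i = \sum_i c 0 i.
  by rewrite [RHS](reindex_inj (@perm_inj _ s)); apply: eq_bigr => i _;
    rewrite mxE.
rewrite !inE; apply/forall_inP/forall_inP => sC c => [Cc | /imsetP[c' Cc' ->]].
  have := sC (row_mx (\sum_i c 0 i)%:M c); rewrite col_perm_lift0 !mem_ext_code.
  by rewrite eqxx Cc => /(_ isT)/andP[].
by rewrite col_perm_lift0 mem_ext_code sumE eqxx sC.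
Qed.

(** A coordinate permutation extends by fixing the parity coordinate, since the sum of the other
    coordinates is invariant; conversely a permutation fixing [ord0] restricts to the rest. *)
Lemma code_aut_isog_stab n (C : {set 'rV['F_2]_n}) :
  ('C_(code_aut (ext_code C))[(ord0 : 'I_(1 + n)) | 'P])%g \isog code_aut C.
Proof.
pose f (s : 'S_n) : 'S_(1 + n) := lift_perm ord0 ord0 s.
have fM : {in code_aut C &, {morph f : s t / (s * t)%g}}.
  by move=> s t _ _; apply/esym/lift_permM.
have f_inj : injective f.
  move=> s t /permP fst; apply/permP=> k; apply: (@lift_inj _ ord0).
  by rewrite -(lift_perm_lift ord0 ord0 s) -(lift_perm_lift ord0 ord0 t) fst.
rewrite isog_sym; apply/isogP; exists (Morphism fM);
  first by apply/injmP=> s t _ _; apply: f_inj.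
apply/setP=> t; apply/imsetP/idP => [[s] | ].
  rewrite setIid => sC -> /=; rewrite inE lift_perm0_ext_aut sC.
  by apply/astab1P; exact: lift_perm_id.
case/setIP => tC /astab1P t0.
have g_ex k : exists l, t (lift ord0 k) = lift ord0 l.
  have /unlift_some[l lE _] : ord0 != t (lift ord0 k).
    by rewrite -[X in X != _]t0 (inj_eq perm_inj) neq_lift.
  by exists l.
have [g gE] := fin_all_exists g_ex.
have g_inj : injective g.
  by move=> k l /(congr1 (lift ord0)); rewrite -!gE => /perm_inj/lift_inj.
have tE : t = f (perm g_inj).
  apply/permP=> i; case: (unliftP ord0 i) => [k ->|->];
    last by rewrite lift_perm_id.
  by rewrite lift_perm_lift permE.
exists (perm g_inj) => //; rewrite setIid.
by move: tC; rewrite tE lift_perm0_ext_aut.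
Qed.

(** * Labelling the coordinates by the vectors of F_2^m *)

(** Every element of F(alpha) is a polynomial in alpha of degree below [F(alpha) : F], which is at
    most dim L. Thus each column of [Hmx] recovers its power of alpha. *)
Lemma exp_mem_span_powers (F : fieldType) (L : fieldExtType F) (alpha : L) i :
  alpha ^+ i \in span [tuple (alpha ^+ k)%R | k < \dim {:L}].
Proof.
have /Fadjoin_poly_eq <- : alpha ^+ i \in <<1; alpha>>%VS.
  by rewrite rpredX ?memv_adjoin.
rewrite horner_coef; apply: memv_suml => k _.
have /polyOverP/(_ k)/vlineP[c ->] := Fadjoin_polyOver 1 alpha (alpha ^+ i).
rewrite -scalerAl mul1r; apply/memvZ/memv_span.
have k_lt : (k < \dim {:L})%N.
  apply: leq_trans (ltn_ord k) (leq_trans (size_Fadjoin_poly _ _ _) _).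
  have := dim_Fadjoin 1 alpha; rewrite dimv1 muln1 => <-.
  exact/dimvS/subvf.
by apply/mapP; exists (Ordinal k_lt); rewrite ?mem_enum.
Qed.

Section HammingPoints.
Variables (L : fieldExtType 'F_2) (alpha : L) (m : nat).
Hypothesis dimL : \dim {:L} = m.
Hypothesis alpha_prim : (2 ^ m - 1)%N.-primitive_root alpha.

Definition ext_point (i : 'I_(1 + (2 ^ m - 1))) : 'rV['F_2]_m :=
  (col i (row_mx 0 (Hmx alpha m)))^T.

Lemma ext_point_lshift k : ext_point (lshift _ k) = 0.
Proof. by apply/rowP=> j; rewrite 2!mxE row_mxEl !mxE. Qed.

Lemma ext_point_rshift k : ext_point (rshift 1 k) = (col k (Hmx alpha m))^T.
Proof. by apply/rowP=> j; rewrite 2!mxE row_mxEr !mxE. Qed.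

Lemma expr_Hmx (k : 'I_(2 ^ m - 1)) :
  alpha ^+ k = \sum_j Hmx alpha m j k *: alpha ^+ j.
Proof.
have := exp_mem_span_powers alpha k; rewrite dimL => /coord_span ->.
by apply: eq_bigr => j _; rewrite mxE -tnth_nth tnth_mktuple.
Qed.

(** The columns are distinct and nonzero because they determine distinct nonzero powers of alpha;
    there are 2^m labels for 2^m vectors, so injectivity suffices. *)
Lemma ext_point_bij : bijective ext_point.
Proof.
have Hcol_inj (k l : 'I_(2 ^ m - 1)) :
    (col k (Hmx alpha m))^T = (col l (Hmx alpha m))^T -> k = l.
  move/trmx_inj/colP=> Hkl; apply: val_inj; apply/eqP.
  rewrite -[_ == _](_ : (k == l %[mod 2 ^ m - 1]) = _);
    last by rewrite !modn_small.
  rewrite -(eq_prim_root_expr alpha_prim) !expr_Hmx; apply/eqP/eq_bigr => j _.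
  by have := Hkl j; rewrite !mxE => ->.
have Hcol_neq0 (k : 'I_(2 ^ m - 1)) : (col k (Hmx alpha m))^T <> 0.
  move/rowP=> Hk0; have := expr_Hmx k; rewrite big1 => [/eqP|j _].
    rewrite expf_eq0 => /andP[_ /eqP alpha0];
      have := prim_expr_order alpha_prim.
    rewrite alpha0 expr0n gtn_eqF ?(prim_order_gt0 alpha_prim) // => /eqP.
    by rewrite eq_sym oner_eq0.
  by have := Hk0 j; rewrite 2!mxE => ->; rewrite [X in X *: _]mxE scale0r.
apply: inj_card_bij => [i j|]; last first.
  by rewrite card_mx card_Fp // card_ord mul1n subnKC // expn_gt0.
case: (split_ordP i) => k ->; case: (split_ordP j) => l ->;
  rewrite ?ext_point_lshift ?ext_point_rshift.
- by rewrite !ord1.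
- by move/esym/Hcol_neq0.
- by move/Hcol_neq0.
- by move/Hcol_inj->.
Qed.

(** The extension condition is an all-ones parity check, and the old rows get entry 0 at infinity.
    For the appended row this matches [wt_quad] at the zero vector because 0 is not among the
    indices. *)
Lemma ext_Ccode (i1 i2 : 'I_4) : (0 < i1)%N -> (0 < i2)%N ->
  ext_code (Ccode alpha m i1 i2) =
  code_of_pcm (quad_pcm ext_point (wt_quad i1 i2)).
Proof.
move=> i1_gt0 i2_gt0.
have -> : quad_pcm ext_point (wt_quad i1 i2) =
    col_mx (col_mx (row_mx 1%:M (const_mx 1)) (row_mx 0 (Hmx alpha m)))
           (row_mx 0 (vrow alpha m i1 i2)).
  rewrite /quad_pcm; congr col_mx; first congr col_mx.
  - rewrite -[const_mx 1 in LHS](@hsubmxK _ 1 1 (2 ^ m - 1)); congr row_mx.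
      by apply/matrixP=> i j; rewrite !mxE !ord1.
    by apply/matrixP=> i j; rewrite !mxE.
  - by apply/matrixP=> i j; rewrite !mxE.
  apply/rowP=> i; rewrite mxE; case: (split_ordP i) => k ->.
    by rewrite ext_point_lshift wt_quad0 // row_mxEl mxE.
  by rewrite ext_point_rshift row_mxEr mxE /wt_quad trmxK.
apply/setP=> c; rewrite -[c]hsubmxK mem_ext_code [RHS]inE tr_row_mx.
rewrite !mul_col_mx !mul_row_col !mul0mx !add0r mul1mx !col_mx_eq0.
rewrite inE mul_col_mx col_mx_eq0 andbA; congr (_ && _ && _).
rewrite addr_eq0 -(inj_eq trmx_inj); congr (_ == _).
apply/matrixP=> i j; rewrite !mxE !ord1 oppF2 mulr1n.
by apply: eq_bigr => k _; rewrite !mxE mul1r.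
Qed.

End HammingPoints.

Theorem theorem2p6 (m : nat) (m_ge4 : (4 <= m)%N) (m_even : ~~ odd m)
    (L : fieldExtType 'F_2) (dimL : \dim {:L} = m)
    (alpha : L) (alpha_prim : (2 ^ m - 1)%N.-primitive_root alpha)
    (i1 i2 : 'I_4) (i12_odd : ((i1 : nat)%:Z - (i2 : nat)%:Z = 1 %[mod 2])%Z)
    (i1_neq0 : (i1 : nat) <> 0%N) (i2_neq0 : (i2 : nat) <> 0%N) :
  let C := Ccode alpha m i1 i2 in
  let Cext := ext_code C in
  (exists K H : {group 'S_(1 + (2 ^ m - 1))},
     [/\ (K ><| H)%g = code_aut Cext,
         K \isog [set: 'rV['F_2]_m]
       & H \isog code_aut C])
  /\ #|code_aut Cext| =
     ((\prod_(1 <= k < (m %/ 2).+1) ((2 ^ (2 * k) - 1) * 2 ^ (2 * k - 1)))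
        * 2 ^ m)%N.
Proof.
move=> C Cext.
have i1_gt0 : (0 < i1)%N by rewrite lt0n; apply/eqP.
have i2_gt0 : (0 < i2)%N by rewrite lt0n; apply/eqP.
have i12 : odd (i1 + i2).
  by case: i1 i12_odd {i1_neq0 i1_gt0 C Cext} => [[|[|[|[|[]]]]]] //= ?;
     case: i2 {i2_neq0 i2_gt0} => [[|[|[|[|[]]]]]].
have m_gt0 : (0 < m)%N by apply: leq_trans m_ge4.
have qD x y := @wt_quadD m i1 i2 x y i12 i1_gt0 i2_gt0.
have e_bij := ext_point_bij dimL alpha_prim.
have CextE : Cext = _ := ext_Ccode alpha m i1_gt0 i2_gt0.
split; last first.
  by rewrite CextE (card_quad_pcm_aut m_even m_gt0 e_bij qD)
    card_coid_isometries.
exists (transl_morphism m_even e_bij @* [set: 'rV['F_2]_m])%G.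
exists ('C_(code_aut Cext)[(ord0 : 'I_(1 + (2 ^ m - 1))) | 'P])%G.
split; [| exact: transl_isog | exact: code_aut_isog_stab].
rewrite CextE; apply: (transl_sdprod m_even m_gt0 e_bij qD).
(* The decomposition is taken at the coordinate at infinity, which must carry the zero vector. *)
apply: etrans (@ext_point_lshift _ alpha m ord0).
by congr (ext_point _ _); apply: val_inj.
Qed.
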